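(* Let $d\geq 6$ be an integer and let $G$ be a finite simple connected $d$-regular graph. Then every proper edge colouring $w$ of $G$ is sequentially orderable, i.e. there is a total order $\prec$ on $E(G)$ such that $f_{\prec}(u)\neq f_{\prec}(v)$ for every edge $uv\in E(G)$.
   Context: An edge colouring (edge weighting) is a map $w:E(G)\to\mathcal C$ into an arbitrary set $\mathcal C$ of colours; it is proper if any two distinct edges sharing an endpoint receive distinct colours. Given a total order $\prec$ on $E(G)$, the vertex colouring induced by $w$ and $\prec$ assigns to each vertex $v$ of degree $d(v)$ the finite sequence $f_{\prec}(v)=(w(e_1),\dots,w(e_{d(v)}))$, where $e_1\prec\dots\prec e_{d(v)}$ are all the edges incident with $v$. The colouring $w$ is called sequentially orderable if there is a total order $\prec$ on $E(G)$ for which $f_{\prec}$ is a proper vertex colouring, i.e. $f_{\prec}(u)\ne f_{\prec}(v)$ for all adjacent $u,v$. *)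

(* Defs.v *)
From mathcomp Require Import all_boot.

Set Implicit Arguments.
Unset Strict Implicit.
Unset Printing Implicit Defensive.

(* A finite simple graph is a symmetric irreflexive relation
   [e] on a finite type [T]; since [e] is symmetric and irreflexive, its edges
   are exactly the two-element sets [set x; y] with [e x y]. *)

Section SequentialOrderings.

Variables (T : finType) (e : rel T).

Definition simple_graph : Prop := symmetric e /\ irreflexive e.

Definition degree (v : T) : nat := #|[set u | e v u]|.

Definition regular (d : nat) : Prop := forall v : T, degree v = d.

Definition connected_graph : Prop := forall u v : T, connect e u v.

Definition edge_set : {set {set T}} :=
  [set [set x; y] | x in T, y in T & e x y].

Definition edge : Type := {A : {set T} | A \in edge_set}.

Definition incident (v : T) (a : edge) : bool := v \in val a.

(* Total orders are given by their reflexive version: [le a b] means that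
   a = b or a precedes b. *)
Definition total_order (le : rel edge) : Prop :=
  [/\ reflexive le, antisymmetric le, transitive le & total le].

(* The colour set is an arbitrary type, so colours and colour sequences are
   compared with Leibniz equality. *)
Variable C : Type.

Definition proper_edge_colouring (w : edge -> C) : Prop :=
  forall (a b : edge) (v : T),
    a <> b -> incident v a -> incident v b -> w a <> w b.

Definition proper_vertex_colouring (K : Type) (f : T -> K) : Prop :=
  forall u v : T, e u v -> f u <> f v.

Definition induced_colouring (w : edge -> C) (le : rel edge) (v : T) : seq C :=
  [seq w a | a <- sort le (enum (incident v))].

Definition sequentially_orderable (w : edge -> C) : Prop :=
  exists le : rel edge,
    total_order le /\ proper_vertex_colouring (induced_colouring w le).

End SequentialOrderings.

(* Main.v *)
(* Take the order induced by a uniformly random permutation p of the edges. For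
   a = uv, let S be the set of the d - 1 edges at v other than a. Permuting S
   changes no order at u, and w is injective on the edges at v, so in each orbit
   of Sym(S) at most a proportion 1 / (d-1)! of the orders satisfies
   f(u) = f(v). Permuting S affects only the events of the at most (d-1)d edges
   that meet N(v) \ u, and 4 (d-1) d <= (d-1)! as soon as d >= 6, so the
   (lopsided) local lemma yields an order that avoids all the events. *)
Require Import Defs.
From mathcomp Require Import all_boot.
From mathcomp Require Import all_fingroup boolp zify.

Set Implicit Arguments.
Unset Strict Implicit.
Unset Printing Implicit Defensive.

(** * The lopsided local lemma, in counting form *)

Section LocalLemma.

Variables (Omega I : finType) (A : I -> {set Omega}).

Definition avoid (X : {set I}) : {set Omega} :=
  [set t | [forall a in X, t \notin A a]].

Lemma avoidP (X : {set I}) t :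
  reflect (forall a, a \in X -> t \notin A a) (t \in avoid X).
Proof. by rewrite inE; apply: forall_inP. Qed.

Lemma avoidS (X Y : {set I}) : X \subset Y -> avoid Y \subset avoid X.
Proof.
move=> /subsetP sXY; apply/subsetP => t /avoidP tY.
by apply/avoidP => a /sXY /tY.
Qed.

Lemma avoidU1 a (X : {set I}) : avoid (a |: X) = avoid X :\: A a.
Proof.
apply/setP => t; rewrite in_setD; apply/avoidP/andP => [tX | [ta /avoidP tX] b].
  split; first by apply: tX; rewrite setU11.
  by apply/avoidP => b bX; apply: tX; rewrite setU1r.
by case/setU1P => [-> // | /tX].
Qed.

Variables m D : nat.
Hypothesis D_gt0 : 0 < D.
Hypothesis leDm : 4 * D <= m.
Hypothesis rare : forall a, exists G : {set I}, #|G| <= D /\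
  forall X : {set I}, a \notin X -> [disjoint X & G] ->
    #|avoid X :&: A a| * m <= #|avoid X|.

(** Strong induction on the size of [X]. Dropping from [X] its at most [D] members in [G] at most
    doubles the avoiding set, so the proportion 1 / m given by [rare] becomes at most 2 / m, and
    [4 * D <= m] turns this into 1 / (2D). *)
Lemma local_lemma_bound (X : {set I}) a : a \notin X ->
  #|avoid X :&: A a| * (2 * D) <= #|avoid X|.
Proof.
have [n] := ubnP #|X|; elim: n X a => // n IHn X a leXn aX.
have [G [leGD rareG]] := rare a.
pose X' := X :\: G.
have sX'X : X' \subset X by exact: subsetDl.
(* Adding back the elements of X that lie in G one by one, each costs at most
   a fraction 1 / (2D) of [avoid X'], and there are at most D of them. *)
have step k : forall Y : {set I}, X' \subset Y -> Y \subset X ->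
    #|Y :\: X'| = k ->
    2 * D * #|avoid X'| <= 2 * D * #|avoid Y| + k * #|avoid X'|.
  elim: k => [|k IHk] Y sX'Y sYX cardY.
    have -> : Y = X'.
      apply/eqP; rewrite eqEsubset sX'Y andbT -setD_eq0.
      by rewrite -cards_eq0 cardY.
    by rewrite mul0n addn0.
  have /card_gt0P[b] : 0 < #|Y :\: X'| by rewrite cardY.
  rewrite in_setD => /andP[bX' bY].
  have sX'Yb : X' \subset Y :\ b by rewrite subsetD1 sX'Y.
  have {}IHk :
      2 * D * #|avoid X'| <= 2 * D * #|avoid (Y :\ b)| + k * #|avoid X'|.
    apply: IHk => //; first exact: subset_trans (subsetDl _ _) sYX.
    have -> : (Y :\ b) :\: X' = (Y :\: X') :\ b by rewrite setDDl setUC -setDDl.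
    by move: cardY; rewrite (cardsD1 b) in_setD bX' bY => -[].
  have ltYbn : #|Y :\ b| < n.
    by have := subset_leq_card sYX; rewrite (cardsD1 b Y) bY; lia.
  have := IHn _ _ ltYbn (negbT (setD11 b Y)).
  have := subset_leq_card (avoidS sX'Yb).
  have := cardsID (A b) (avoid (Y :\ b)).
  rewrite -avoidU1 setD1K //.
  by move: IHk; nia.
have cardXX' : #|X :\: X'| <= D.
  apply: leq_trans leGD; apply: subset_leq_card; apply/subsetP => b.
  by rewrite !inE => /andP[/nandP[/negPn // | /negPf -> //]].
(* The losses add up to at most D / (2D) = 1 / 2 of [avoid X']. *)
have half : #|avoid X'| <= 2 * #|avoid X|.
  by have := step _ X sX'X (subxx X) erefl; nia.
have : #|avoid X' :&: A a| * m <= #|avoid X'|.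
  apply: rareG; first by rewrite !inE (negPf aX) andbF.
  by rewrite -setI_eq0 setIDAC setDIl setDv setI0.
have := subset_leq_card (setSI (A a) (avoidS sX'X)).
nia.
Qed.

(** Events are added one at a time: each removes at most a proportion 1 / (2D) <= 1 / 2 of the
    avoiding set, which therefore never becomes empty. *)
Lemma local_lemma : 0 < #|Omega| -> exists t, forall a, t \notin A a.
Proof.
move=> Omega_gt0.
have avoid_gt0 n : forall X : {set I}, #|X| = n -> 0 < #|avoid X|.
  elim: n => [|n IHn] X cardX.
    move/eqP: cardX; rewrite cards_eq0 => /eqP ->.
    suff -> : avoid set0 = setT by rewrite cardsT.
    by apply/setP => t; rewrite in_setT; apply/avoidP => a; rewrite inE.
  have /card_gt0P[b bX] : 0 < #|X| by rewrite cardX.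
  have Xb_gt0 : 0 < #|avoid (X :\ b)|.
    by apply: IHn; move: cardX; rewrite (cardsD1 b) bX => -[].
  have := local_lemma_bound (negbT (setD11 b X)).
  have := cardsID (A b) (avoid (X :\ b)).
  rewrite -avoidU1 setD1K //.
  nia.
have /card_gt0P[t /avoidP tT] := avoid_gt0 _ [set: I] erefl.
by exists t => a; apply: tT.
Qed.

End LocalLemma.

(** * Orders induced by permutations *)

Section PermutationOrders.

Variable E : finType.

(** Sym(S) acts on these orders by left multiplication: [s * p] applies [s] first, so it ranks [x]
    as [p] ranks [s x]. *)
Definition perm_le (p : {perm E}) : rel E :=
  [rel x y | enum_rank (p x) <= enum_rank (p y)].

Lemma perm_le_total p : total (perm_le p).
Proof. by move=> x y; apply: leq_total. Qed.

Lemma perm_le_trans p : transitive (perm_le p).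
Proof. by move=> y x z; apply: leq_trans. Qed.

Lemma perm_le_anti p : antisymmetric (perm_le p).
Proof.
move=> x y; rewrite -eqn_leq => /eqP/val_inj/enum_rank_inj.
exact: perm_inj.
Qed.

Lemma map_sort_perm_le (s p : {perm E}) (r : seq E) :
  map s (sort (perm_le (s * p)) r) = sort (perm_le p) (map s r).
Proof.
rewrite sort_map; congr (map _ (sort _ _)).
by apply/funext => x; apply/funext => y; rewrite /perm_le /= !permM.
Qed.

Lemma sort_perm_le_fix (s p : {perm E}) (r : seq E) :
  {in r, forall x, s x = x} ->
  sort (perm_le (s * p)) r = sort (perm_le p) r.
Proof.
move=> fix_r; have := map_sort_perm_le s p r.
by rewrite !map_id_in // => x; rewrite mem_sort; apply: fix_r.
Qed.

(** [B] is a union of orbits of Sym(S), each of size |S|! and meeting [A] at most once. Concretely,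
    (p, s) -> [s * p] is injective from ([B :&: A]) x Sym(S) into [B]. *)
Lemma card_perm_on_unique (S : {set E}) (B A : {set {perm E}}) :
  (forall s p, perm_on S s -> p \in B -> (s * p)%g \in B) ->
  (forall s p, perm_on S s -> p \in A -> (s * p)%g \in A -> s = 1%g) ->
  #|B :&: A| * #|S|`! <= #|B|.
Proof.
move=> stableB uniqueA; rewrite -card_perm -[#|perm_on S|]cardsE -cardsX.
pose f (q : {perm E} * {perm E}) := (q.2 * q.1)%g.
rewrite -(@card_in_imset _ _ f) => [|[p s] [p' s']].
  apply/subset_leq_card/subsetP => _ /imsetP[[p s] + ->].
  by rewrite !inE => /andP[/andP[pB _] Ss]; apply: stableB.
rewrite !inE /f /= => /andP[/andP[_ pA] Ss] /andP[/andP[_ p'A] Ss'] eq_sp.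
have def_p' : p' = (s'^-1 * s * p)%g by rewrite -mulgA eq_sp mulKg.
have /eqP : (s'^-1 * s)%g = 1%g.
  apply: (uniqueA _ p) => //; last by rewrite -def_p'.
  exact: perm_onM (perm_onV Ss') Ss.
rewrite -eq_mulVg1 => /eqP eq_s.
by move: def_p'; rewrite eq_s mulVg mul1g => ->.
Qed.

End PermutationOrders.

Lemma map_inj_in_seq (T : eqType) (U : Type) (f : T -> U) (P : {pred T})
    (r s : seq T) :
  {in P &, injective f} -> {subset r <= P} -> {subset s <= P} ->
  map f r = map f s -> r = s.
Proof.
move=> injf; elim: r s => [|x r IHr] [|y s] //= sr ss [eq_xy /IHr eq_rs].
congr (_ :: _).
  by apply: injf eq_xy; [apply: sr | apply: ss]; rewrite mem_head.
by apply: eq_rs => z zr; [apply: sr | apply: ss]; rewrite in_cons zr orbT.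
Qed.

Lemma fact_lower_bound k : 5 <= k -> 4 * (k * k.+1) <= k`!.
Proof.
(* At k = 5 both sides equal 120, whence the threshold 6 for the degree. *)
elim: k => // k IHk; rewrite leq_eqVlt => /predU1P[[<-] // | lt5k].
by have := IHk lt5k; rewrite factS; nia.
Qed.

(** * Incidence in simple regular graphs *)

Section RegularGraph.

Variables (T : finType) (e : rel T).
Hypothesis hG : simple_graph e.

Lemma edgeP (a : edge e) : exists u v, e u v /\ val a = [set u; v].
Proof.
by have /imset2P[u v _ /[!inE] /andP[_ uv] ->] := valP a; exists u, v.
Qed.

Lemma edge_of u v : e u v -> exists a : edge e, val a = [set u; v].
Proof.
move=> uv; have ab : [set u; v] \in edge_set e.
  by apply/imset2P; exists u v; rewrite ?inE.
by exists (Sub [set u; v] ab).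
Qed.

Lemma edge_adj (a : edge e) x y : x \in val a -> y \in val a -> x != y -> e x y.
Proof.
have [sym_e _] := hG.
have [u [v [uv ->]]] := edgeP a; rewrite !inE.
by move=> /orP[]/eqP-> /orP[]/eqP->; rewrite ?eqxx // sym_e.
Qed.

Lemma edge_determined (a b : edge e) x y :
  x \in val a -> y \in val a -> x \in val b -> y \in val b -> x != y -> a = b.
Proof.
have two (c : edge e) :
    x \in val c -> y \in val c -> x != y -> val c = [set x; y].
  have [u [v [_ ->]]] := edgeP c; rewrite !inE.
  move=> /orP[]/eqP-> /orP[]/eqP->; rewrite ?eqxx // => _.
  exact: setUC.
move=> xa ya xb yb xy; apply: val_inj.
exact: etrans (two a xa ya xy) (esym (two b xb yb xy)).
Qed.

Lemma card_incident v : #|[set a : edge e | incident v a]| = degree e v.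
Proof.
have [sym_e irr_e] := hG.
(* The endpoint of [a] other than [v]; the default [v] is never reached on edges at [v], because [e]
   is irreflexive. *)
pose f (a : edge e) := odflt v [pick u | (u != v) && (u \in val a)].
have fP (a : edge e) : v \in val a -> f a != v /\ f a \in val a.
  move=> va; rewrite /f; case: pickP => [u /andP[] //|none].
  have [x [y [xy da]]] := edgeP a; move: va (none x) (none y) xy.
  rewrite da !inE !eqxx orbT !andbT => /orP[]/eqP-> /negbFE/eqP.
    by move=> _ /negbFE/eqP ->; rewrite irr_e.
  by move=> -> _; rewrite irr_e.
rewrite -(@card_in_imset _ _ f) => [|a b]; last first.
  rewrite !inE => va vb eq_f; have [fva fa] := fP a va; have [_ fb] := fP b vb.
  by apply: (@edge_determined a b (f a) v) => //; rewrite eq_f.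
apply/eq_card => u; rewrite inE; apply/imsetP/idP => [[a] | vu].
  rewrite inE => va ->; have [fva fa] := fP a va.
  by apply: edge_adj va fa _; rewrite eq_sym.
have [a da] := edge_of vu; have va : v \in val a by rewrite da !inE eqxx.
exists a; first by rewrite inE.
by have [fva] := fP a va; rewrite da !inE (negPf fva) => /eqP.
Qed.

Variable d : nat.
Hypothesis hreg : regular e d.

Lemma card_meeting (N : {set T}) :
  #|\bigcup_(z in N) [set a : edge e | incident z a]| <= #|N| * d.
Proof.
rewrite -sum_nat_const.
elim/big_rec2: _ => [|z n U _ leU]; first by rewrite cards0.
apply: leq_trans (leq_card_setU _ _) _.
by rewrite card_incident hreg leq_add2l.
Qed.

(** * The bad events and their dependencies *)

Variables (C : Type) (w : edge e -> C).
Hypothesis hw : proper_edge_colouring w.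

(** Quantifying over all pairs of endpoints avoids orienting [a]; the classical truth value is there
    because [C] has no decidable equality. *)
Definition monochromatic (a : edge e) : {set {perm edge e}} :=
  [set p | `[< forall x y, x \in val a -> y \in val a ->
     induced_colouring w (perm_le p) x = induced_colouring w (perm_le p) y >]].

Lemma induced_colouring_fix (s p : {perm edge e}) x :
  (forall c, incident x c -> s c = c) ->
  induced_colouring w (perm_le (s * p)) x = induced_colouring w (perm_le p) x.
Proof.
move=> fixs; rewrite /induced_colouring sort_perm_le_fix // => c.
by rewrite mem_enum; apply: fixs.
Qed.

(** The only edge shared by [u] and [v] is [a], so [s] fixes all edges at [u] and the sequence at
    [u] is the same for both orders. Hence so is the one at [v], where distinct colours let the
    order of the edges be read off. *)
Lemma monochromatic_unique (a : edge e) u v (s p : {perm edge e}) :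
  e u v -> val a = [set u; v] ->
  perm_on ([set c | incident v c] :\ a) s ->
  p \in monochromatic a -> (s * p)%g \in monochromatic a -> s = 1%g.
Proof.
have [sym_e irr_e] := hG.
move=> uv da Ss; rewrite !inE => /asboolP mono_p /asboolP mono_sp.
have neq_uv : u != v by apply: contraTneq uv => ->; rewrite irr_e.
have [ua va] : u \in val a /\ v \in val a by rewrite da !inE !eqxx orbT.
have fix_u c : incident u c -> s c = c.
  move=> uc; apply: (out_perm Ss); rewrite !inE.
  apply/negP => /andP[/eqP ca vc]; apply: ca.
  exact: (@edge_determined c a u v).
have eq_col : induced_colouring w (perm_le (s * p)) v
            = induced_colouring w (perm_le p) v.
  by rewrite -(mono_sp u v ua va) -(mono_p u v ua va) induced_colouring_fix.
have eq_sort : sort (perm_le (s * p)) (enum (incident v))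
             = sort (perm_le p) (enum (incident v)).
  apply: (map_inj_in_seq (P := incident v) _ _ _ eq_col).
  - move=> b c vb vc eq_w; apply/eqP/negPn/negP => /eqP neq_bc.
    exact: (hw neq_bc vb vc eq_w).
  - by move=> c; rewrite mem_sort mem_enum.
  - by move=> c; rewrite mem_sort mem_enum.
(* [s] permutes the edges at [v], since it preserves S and fixes [a]. *)
have sE : perm_eq (map s (enum (incident v))) (enum (incident v)).
  apply: uniq_perm; rewrite ?(map_inj_uniq perm_inj) ?enum_uniq //.
  move=> c; apply/mapP/idP => [[b] | ].
    rewrite !mem_enum => vb ->.
    have [bS | bS] := boolP (b \in [set c | incident v c] :\ a).
      by move: bS; rewrite -(perm_closed b Ss) !inE => /andP[].
    by rewrite (out_perm Ss bS).
  rewrite mem_enum => vc; exists (s^-1%g c); last by rewrite permKV.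
  rewrite mem_enum.
  have [cS | cS] := boolP (c \in [set c | incident v c] :\ a).
    by move: cS; rewrite -(perm_closed c (perm_onV Ss)) !inE => /andP[].
  by rewrite (out_perm (perm_onV Ss) cS).
(* Hence s maps the sorted list of the edges at v to itself. *)
have := map_sort_perm_le s p (enum (incident v)).
have /(perm_sortP (@perm_le_total _ p) (@perm_le_trans _ p)
  (@perm_le_anti _ p)) -> := sE.
rewrite eq_sort -[RHS]map_id => /eq_in_map fix_v.
apply/permP => c; rewrite perm1.
have [cS | cS] := boolP (c \in [set c | incident v c] :\ a);
  last exact: out_perm Ss cS.
apply: fix_v; rewrite mem_sort mem_enum.
by move: cS; rewrite !inE => /andP[].
Qed.

(** No edge at an endpoint of [b] is moved by [s], so both colour sequences are unchanged. The edge
    [b] may still pass through [u]. *)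
Lemma monochromatic_stable (a b : edge e) u v (s p : {perm edge e}) :
  val a = [set u; v] -> b != a ->
  (forall z, e v z -> z != u -> z \notin val b) ->
  perm_on ([set c | incident v c] :\ a) s ->
  ((s * p)%g \in monochromatic b) = (p \in monochromatic b).
Proof.
move=> da neq_ba far Ss.
(* Otherwise the other end of [b] would be a neighbour of [v], hence [u] by [far], forcing
   [b = a]. *)
have vb : v \notin val b.
  have [sym_e irr_e] := hG.
  have [x [y [xy db]]] := edgeP b; have yx : e y x by rewrite sym_e.
  apply/negP; rewrite db !inE => /orP[]/eqP def_v.
    have : y \in val b by rewrite db !inE eqxx orbT.
    apply/negP/far; first by rewrite def_v.
    apply: contra neq_ba => /eqP def_y.
    by rewrite -val_eqE da db def_v def_y setUC.
  have : x \in val b by rewrite db !inE eqxx.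
  apply/negP/far; first by rewrite def_v.
  by apply: contra neq_ba => /eqP def_x; rewrite -val_eqE da db def_v def_x.
have fixb x : x \in val b ->
    induced_colouring w (perm_le (s * p)) x = induced_colouring w (perm_le p) x.
  move=> xb; apply: induced_colouring_fix => c xc; apply: (out_perm Ss).
  rewrite !inE; apply/negP => /andP[neq_ca vc].
  (* A moved edge [c] at [x] would join [v] to [x]; by [far] this leaves [x = u], so [c = a], which
     is excluded from S. *)
  have neq_vx : v != x by apply: contraNneq vb => ->.
  have vx : e v x := edge_adj vc xc neq_vx.
  have [eq_xu | neq_xu] := eqVneq x u.
    case/negP: neq_ca; apply/eqP.
    by apply: (@edge_determined c a v x) => //; rewrite da !inE ?eq_xu eqxx ?orbT.
  by case/negP: (far x vx neq_xu).
rewrite !inE; apply/asboolP/asboolP => mono x y xb yb.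
  by rewrite -!fixb //; apply: mono.
by rewrite !fixb //; apply: mono.
Qed.

(** [G] consists of the edges meeting N(v) minus [u]. For [X] disjoint from [G] and without [a],
    [avoid monochromatic X] is stable under Sym(S), where S has d - 1 elements. *)
Lemma monochromatic_rare (a : edge e) : exists G : {set edge e},
  #|G| <= d.-1 * d /\
  forall X : {set edge e}, a \notin X -> [disjoint X & G] ->
    #|avoid monochromatic X :&: monochromatic a| * (d.-1)`!
      <= #|avoid monochromatic X|.
Proof.
have [sym_e irr_e] := hG.
have [u [v [uv da]]] := edgeP a.
pose N := [set z | e v z] :\ u.
have cardN : #|N| = d.-1.
  by have := hreg v; rewrite /degree (cardsD1 u) inE sym_e uv => <-.
exists (\bigcup_(z in N) [set c : edge e | incident z c]); split.
  by rewrite -cardN; apply: card_meeting.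
move=> X aX disX.
have <- : #|[set c : edge e | incident v c] :\ a| = d.-1.
  have := hreg v; rewrite -card_incident (cardsD1 a) inE /incident da.
  by rewrite !inE eqxx orbT => <-.
apply: card_perm_on_unique => s p Ss; last exact: monochromatic_unique uv da Ss.
move=> /avoidP pX; apply/avoidP => b bX.
rewrite (monochromatic_stable p da _ _ Ss) ?pX //.
  by apply: contraNneq aX => <-.
move=> z vz neq_zu; apply/negP => zb.
have /negP[] := disjointFr disX bX; apply/bigcupP; exists z; rewrite !inE //.
by rewrite neq_zu.
Qed.

End RegularGraph.

Theorem theorem9 (d : nat) (hd : 6 <= d)
    (T : finType) (e : rel T)
    (hG : simple_graph e) (hconn : connected_graph e) (hreg : regular e d)
    (C : Type) (w : edge e -> C) (hw : proper_edge_colouring w) :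
  sequentially_orderable w.
Proof.
have D_gt0 : 0 < d.-1 * d by nia.
have leDm : 4 * (d.-1 * d) <= (d.-1)`!.
  by case: d hd {hreg D_gt0} => // k lt5k; apply: fact_lower_bound.
have Omega_gt0 : 0 < #|{perm edge e}| by apply/card_gt0P; exists 1%g.
have [p good] := local_lemma D_gt0 leDm (monochromatic_rare hG hreg hw) Omega_gt0.
exists (perm_le p); split.
  split; [exact: (fun x => leqnn _) | exact: perm_le_anti
         | exact: perm_le_trans | exact: perm_le_total].
move=> u v uv eq_uv; have [a da] := edge_of uv.
(* As [a] has only the endpoints [u] and [v], the single equality [eq_uv] covers all pairs. *)
have /negP[] := good a; rewrite inE; apply/asboolP => x y.
by rewrite da !inE => /orP[]/eqP-> /orP[]/eqP->.
Qed.
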